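(* Let $\{\alpha_k\}_{k\in\mathbb{Z}}$ be a sequence of complex numbers with $|\alpha_k|<1$ for all $k\in\mathbb{Z}$, and let $U$ be the associated full-lattice CMV operator on $\ell^2(\mathbb{Z})$. Fix $t_1,t_2\in[0,2\pi)$, $k_0\in\mathbb{Z}$, $z\in\mathbb{C}$ with $|z|\neq 1$, and let $U^{(t_1,t_2)}_{k_0}$ be the unitary operator on $\ell^2(\mathbb{Z})=\ell^2((-\infty,k_0-1]\cap\mathbb{Z})\oplus\ell^2([k_0,\infty)\cap\mathbb{Z})$ given by $$U^{(t_1,t_2)}_{k_0}=U^{(t_1)}_{-,k_0-1}\oplus U^{(t_2)}_{+,k_0}.$$ Then $U-U^{(t_1,t_2)}_{k_0}$ and $(U-zI)^{-1}-\big(U^{(t_1,t_2)}_{k_0}-zI\big)^{-1}$ are of rank one if and only if $$t_1=2\arg\big[i(\alpha_{k_0}e^{-it_2/2}-e^{it_2/2})\big]\quad(\text{mod }2\pi).$$ Otherwise, these differences are of rank two. In particular, $U-U^{(t)}_{k_0}$ and $(U-zI)^{-1}-\big(U^{(t)}_{k_0}-zI\big)^{-1}$ are of rank two for any $t\in[0,2\pi)$, where $U^{(t)}_{k_0}=U^{(t)}_{-,k_0-1}\oplus U^{(t)}_{+,k_0}$.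
   Context: Set $\rho_k=(1-|\alpha_k|^2)^{1/2}$ and $\Theta_k=\begin{pmatrix}-\alpha_k&\rho_k\\ \rho_k&\overline{\alpha_k}\end{pmatrix}$ for $k\in\mathbb{Z}$. Let $V$ and $W$ be the block-diagonal unitary operators on $\ell^2(\mathbb{Z})$ whose matrices in the standard basis $\{\delta_k\}_{k\in\mathbb{Z}}$ are built from $2\times2$ blocks as follows: for each even $k$, $V$ has the block $\Theta_k$ in rows and columns $(k-1,k)$; for each odd $k$, $W$ has the block $\Theta_k$ in rows and columns $(k-1,k)$; all other entries vanish. The (full-lattice) CMV operator is $U=VW$. For $t\in[0,2\pi)$ and $k_0\in\mathbb{Z}$, replace $\alpha_{k_0}$ by $e^{it}$ (so $\rho_{k_0}$ becomes $0$ and $\Theta_{k_0}$ becomes $\mathrm{diag}(-e^{it},e^{-it})$), leaving all other $\alpha_k$ unchanged. The operators obtained from $V,W,U$ in this way are denoted $V^{(t)}_{k_0},W^{(t)}_{k_0},U^{(t)}_{k_0}=V^{(t)}_{k_0}W^{(t)}_{k_0}$; each splits as a direct sum of an operator on $\ell^2((-\infty,k_0-1]\cap\mathbb{Z})$ and one on $\ell^2([k_0,\infty)\cap\mathbb{Z})$. The summands are denoted with subscripts $-,k_0-1$ and $+,k_0$; thus $U^{(t)}_{k_0}=U^{(t)}_{-,k_0-1}\oplus U^{(t)}_{+,k_0}$ (half-lattice CMV operators). *)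

(* Defs.v *)
From HB Require Import structures.
From mathcomp Require Import all_boot all_order all_algebra.
From mathcomp Require Import all_classical all_reals all_analysis.
From mathcomp.real_closed Require Import complex.
From mathcomp Require Import ring lra zify.

Set Implicit Arguments.
Unset Strict Implicit.
Unset Printing Implicit Defensive.
Import Order.TTheory GRing.Theory Num.Theory.
Import numFieldNormedType.Exports.
Local Open Scope classical_set_scope.
Local Open Scope ring_scope.

Section SquareSummable.
Variables (R : realType) (I : choiceType).
Implicit Types (u v : I -> R) (f g h : I -> R[i]).

Definition sqr_summable f :=
  summable [set: I] (fun k => (Normc.normc (f k) ^+ 2)%:E).

Lemma summable_lin u v (c : R) :
    (forall k, 0 <= u k <= c * v k) -> summable setT (EFin \o v) ->
  summable setT (EFin \o u).
Proof.
move=> uv sv.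
have sMn n : summable setT (fun k => (v k *+ n)%:E).
  elim: n => [|n IHn].
    by rewrite /summable esum1 ?ltry// => i _; rewrite mulr0n abse0.
  have := summableD sv IHn; congr (is_true (summable _ _)).
  by apply/funext => k; rewrite mulrS EFinD.
have := sMn (Num.truncn `|c|).+1; rewrite /summable; apply: le_lt_trans.
apply: le_esum => k _ /=.
rewrite lee_fin; have /andP[u0 uc] := uv k.
rewrite (ger0_norm u0) (le_trans uc)// (le_trans (ler_norm _))// normrM.
rewrite normrMn -[leRHS]mulr_natl ler_wpM2r//.
exact: ltW (truncnS_gt _).
Qed.

Lemma sqr_summable_le2 f g h (c : R) :
    (forall k, Normc.normc (h k) ^+ 2 <=
       c * (Normc.normc (f k) ^+ 2 + Normc.normc (g k) ^+ 2)) ->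
  sqr_summable f -> sqr_summable g -> sqr_summable h.
Proof.
move=> hfg sf sg.
apply: (@summable_lin _ (fun k => Normc.normc (f k) ^+ 2 + Normc.normc (g k) ^+ 2) c).
  by move=> k; rewrite sqr_ge0 hfg.
exact: summableD sf sg.
Qed.

Lemma normc_sqrD (x y : R[i]) :
  Normc.normc (x + y) ^+ 2 <=
    2 * (Normc.normc x ^+ 2 + Normc.normc y ^+ 2).
Proof.
case: x y => [a b] [c d] /=; rewrite !sqr_sqrtr ?addr_ge0 ?sqr_ge0//.
have := sqr_ge0 (a - c); have := sqr_ge0 (b - d); nra.
Qed.

Lemma normc_sqr_lin (a b x y : R[i]) (A : R) :
    Normc.normc a ^+ 2 <= A -> Normc.normc b ^+ 2 <= A ->
  Normc.normc (a * x + b * y) ^+ 2 <=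
    2 * A * (Normc.normc x ^+ 2 + Normc.normc y ^+ 2).
Proof.
move=> aA bA; apply: le_trans (normc_sqrD _ _) _.
rewrite -mulrA ler_pM2l// mulrDr lerD// Normc.normcM exprMn ler_wpM2r//.
  exact: sqr_ge0.
exact: sqr_ge0.
Qed.

Definition l2pred : {pred (I -> R[i])} := fun f => `[< sqr_summable f >].

Lemma l2pred_submod : submod_closed l2pred.
Proof.
split.
  apply/asboolP; rewrite /sqr_summable /summable esum1 ?ltry// => k _.
  by rewrite Normc.normc0 expr0n abse0.
move=> a f g /asboolP sf /asboolP sg; apply/asboolP.
apply: (@sqr_summable_le2 f g _ (2 * (Normc.normc a ^+ 2 + 1))) => // k.
have := @normc_sqr_lin a 1 (f k) (g k) (Normc.normc a ^+ 2 + 1).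
rewrite mul1r Normc.normc1 expr1n lerDl lerDr sqr_ge0; exact.
Qed.

HB.instance Definition _ :=
  GRing.isSubmodClosed.Build R[i] (I -> R[i]) l2pred l2pred_submod.

Record ell2 := Ell2 { l2val :> I -> R[i]; _ : l2pred l2val }.
HB.instance Definition _ := [isSub for l2val].
HB.instance Definition _ := [Choice of ell2 by <:].
HB.instance Definition _ := [SubChoice_isSubLmodule of ell2 by <:].

Definition MkEll2 f (sf : sqr_summable f) : ell2 := Ell2 (asboolT sf).

Lemma ell2P (f : ell2) : sqr_summable f.
Proof. by case: f => f pf; apply/asboolP. Qed.

Lemma ell2_eqP (f g : ell2) : (forall k, f k = g k) -> f = g.
Proof. by move=> fg; apply/val_inj/funext. Qed.

Lemma ell2DE (f g : ell2) k : (f + g) k = f k + g k.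
Proof. by []. Qed.

Lemma ell2ZE (a : R[i]) (f : ell2) k : (a *: f) k = a * f k.
Proof. by []. Qed.

End SquareSummable.

Section CMV.
Variable R : realType.
Local Notation C := R[i].

(* The bound 1 rather than a strict one, so that a coefficient may be replaced
   by a number of modulus 1 (cf. decoupled). *)
Record verblunsky := Verblunsky {
  vcoef :> int -> C;
  vcoef_le1 : forall k, `|vcoef k| <= 1 }.

Definition rho (a : C) : C := (Num.sqrt (1 - Normc.normc a ^+ 2))%:C%C.

(* Rows and columns 0, 1 of Theta alpha_k stand for the positions k - 1, k. *)
Definition Theta (a : C) : 'M[C]_2 :=
  \matrix_(i, j) if i != j then rho a else if i == 0 then - a else (a^*)%C.

Definition oddz (k : int) : bool := odd `|k|%N.

(* The block-diagonal operator with the blocks Theta_k in rows and columns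
   (k-1, k), k running over the integers with oddz k = b. *)
Definition block_fun (b : bool) (alpha : int -> C) (f : int -> C) (k : int) : C :=
  if oddz k == b
  then Theta (alpha k) 1 0 * f (k - 1) + Theta (alpha k) 1 1 * f k
  else Theta (alpha (k + 1)) 0 0 * f k + Theta (alpha (k + 1)) 0 1 * f (k + 1).

Lemma Theta_le1 (a : C) i j : `|a| <= 1 -> Normc.normc (Theta a i j) ^+ 2 <= 1.
Proof.
have -> : `|a| = (Normc.normc a)%:C%C by case: a.
rewrite -[1]/(1%:C%C) lecR => a1.
have na0 : 0 <= Normc.normc a by case: (a) => x y; exact: sqrtr_ge0.
have a2 : Normc.normc a ^+ 2 <= 1 by rewrite expr_le1.
rewrite mxE; case: ifP => _.
  rewrite /rho /= expr0n/= addr0 sqrtr_sqr ger0_norm ?sqrtr_ge0//.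
  by rewrite sqr_sqrtr ?subr_ge0// gerBl sqr_ge0.
case: ifP => _; first by rewrite normcN.
by case: (a) a2 => x y /=; rewrite sqrrN.
Qed.

Definition partner (b : bool) (k : int) : int :=
  if oddz k == b then k - 1 else k + 1.

Lemma oddzS k : oddz (k + 1) = ~~ oddz k.
Proof. rewrite /oddz; lia. Qed.

Lemma oddzB k : oddz (k - 1) = ~~ oddz k.
Proof. rewrite /oddz; lia. Qed.

Lemma partnerK b : involutive (partner b).
Proof.
move=> k; rewrite /partner; case: (boolP (oddz k == b)) => kb.
  by rewrite oddzB; case: ifP => [|_]; [case: (oddz k) b kb => -[]|lia].
by rewrite oddzS; case: ifP => [_|]; [lia|case: (oddz k) b kb => -[]].
Qed.

Lemma sqr_summable_partner b (f : int -> C) :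
  sqr_summable f -> sqr_summable (f \o partner b).
Proof.
rewrite /sqr_summable /summable.
rewrite (@reindex_esum _ _ _ setT setT (partner b))//.
split=> // [x y _ _ /(can_inj (@partnerK b))//|x _].
by exists (partner b x); rewrite // partnerK.
Qed.

Lemma block_fun_summable b (alpha : verblunsky) (f : ell2 R int) :
  sqr_summable (block_fun b alpha f).
Proof.
have sf := ell2P f.
apply: (@sqr_summable_le2 _ _ f (f \o partner b) _ (2 * 1)) => //; last first.
  exact: sqr_summable_partner.
move=> k; rewrite /block_fun /= /partner; case: ifP => _.
  rewrite [X in _ <= _ * X]addrC.
  by apply: normc_sqr_lin; apply: Theta_le1; exact: vcoef_le1.
by apply: normc_sqr_lin; apply: Theta_le1; exact: vcoef_le1.
Qed.

Definition block_op b (alpha : verblunsky) (f : ell2 R int) : ell2 R int :=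
  MkEll2 (block_fun_summable b alpha f).

Lemma block_op_linear b alpha : linear (block_op b alpha).
Proof.
move=> a f g; apply: ell2_eqP => k.
have E j : (a *: f + g) j = a * f j + g j by [].
rewrite !(ell2DE, ell2ZE) [l2val _ _]/(block_fun _ _ _ _) [l2val (block_op _ _ f) _]/(block_fun _ _ _ _) [l2val (block_op _ _ g) _]/(block_fun _ _ _ _) /block_fun !E.
case: ifP => _; ring.
Qed.

HB.instance Definition _ b alpha :=
  GRing.isLinear.Build C (ell2 R int) (ell2 R int) *:%R (block_op b alpha)
    (block_op_linear b alpha).

Definition opV (alpha : verblunsky) := block_op false alpha.
Definition opW (alpha : verblunsky) := block_op true alpha.
Definition cmv (alpha : verblunsky) : ell2 R int -> ell2 R int :=
  opV alpha \o opW alpha.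
HB.instance Definition _ alpha := GRing.Linear.on (cmv alpha).

Definition expi (t : R) : C := (cos t +i* sin t)%C.

Lemma normc_expi t : `|expi t| = 1.
Proof. by rewrite normc_def /= cos2Dsin2 sqrtr1. Qed.

Definition set_coef (alpha : int -> C) (k0 : int) (a : C) (k : int) : C :=
  if k == k0 then a else alpha k.

Lemma set_coef_expi_le1 (alpha : verblunsky) k0 t k :
  `|set_coef alpha k0 (expi t) k| <= 1.
Proof. by rewrite /set_coef; case: ifP => _; rewrite ?normc_expi ?vcoef_le1. Qed.

Definition decoupled (alpha : verblunsky) (k0 : int) (t : R) : verblunsky :=
  Verblunsky (set_coef_expi_le1 alpha k0 t).

Section Restriction.
Variable A : {pred int}.

Lemma restr_summable (f : ell2 R int) :
  sqr_summable (fun k : {k : int | k \in A} => f (val k)).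
Proof.
have sf := ell2P f; rewrite /sqr_summable /summable.
rewrite -(@esum_image _ _ _ setT val
  (fun k => `|(Normc.normc (f k) ^+ 2)%:E|%E)); last by move=> x y _ _ /val_inj.
apply: le_lt_trans sf; rewrite esum_mkcond; apply: le_esum => k _.
by case: ifP.
Qed.

Definition restr (f : ell2 R int) : ell2 R {k : int | k \in A} :=
  MkEll2 (restr_summable f).

Definition ext0_fun (f : {k : int | k \in A} -> C) (k : int) : C :=
  if insub k is Some k' then f k' else 0.

Lemma ext0_summable (f : ell2 R {k : int | k \in A}) :
  sqr_summable (ext0_fun f).
Proof.
have := ell2P f; rewrite /sqr_summable /summable.
have -> : \esum_(x in [set: {k : int | k \in A}])
    `|(Normc.normc (f x) ^+ 2)%:E|%E =
  \esum_(x in [set: {k : int | k \in A}])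
    `|(Normc.normc (ext0_fun f (val x)) ^+ 2)%:E|%E.
  by apply: eq_esum => x _; rewrite /ext0_fun valK.
rewrite -(@esum_image _ _ _ setT val
  (fun k => `|(Normc.normc (ext0_fun f k) ^+ 2)%:E|%E)); last first.
  by move=> x y _ _ /val_inj.
apply: le_lt_trans; rewrite [leRHS]esum_mkcond; apply: le_esum => k _.
case: ifPn => // /negP kA; rewrite /ext0_fun; case: insubP => [k' _ kk'|_].
  by exfalso; apply: kA; rewrite inE /=; exists k'.
by rewrite Normc.normc0 expr0n abse0.
Qed.

Definition ext0 (f : ell2 R {k : int | k \in A}) : ell2 R int :=
  MkEll2 (ext0_summable f).

Lemma restr_linear : linear restr.
Proof. by move=> a f g; apply: ell2_eqP => k. Qed.

Lemma ext0_linear : linear ext0.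
Proof.
move=> a f g; apply: ell2_eqP => k; rewrite ell2DE ell2ZE /= /ext0_fun.
by case: insub => [k'|]; rewrite ?ell2DE ?ell2ZE// mulr0 addr0.
Qed.

HB.instance Definition _ := GRing.isLinear.Build C _ _ *:%R restr restr_linear.
HB.instance Definition _ := GRing.isLinear.Build C _ _ *:%R ext0 ext0_linear.

Definition compress (T : ell2 R int -> ell2 R int) :
    ell2 R {k : int | k \in A} -> ell2 R {k : int | k \in A} :=
  restr \o T \o ext0.

End Restriction.
(* l^2(Z) is identified with the sum of the l^2 spaces of the two half-lattices
   through extension by zero. *)
Definition lhalf (k0 : int) : {pred int} := fun k => k <= k0 - 1.
Definition rhalf (k0 : int) : {pred int} := fun k => k0 <= k.

Definition dsum (k0 : int)
    (S : ell2 R {k : int | k \in lhalf k0} -> ell2 R {k : int | k \in lhalf k0})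
    (T : ell2 R {k : int | k \in rhalf k0} -> ell2 R {k : int | k \in rhalf k0})
    (f : ell2 R int) : ell2 R int :=
  ext0 (S (restr _ f)) + ext0 (T (restr _ f)).

(* cmv (decoupled alpha k0 t) leaves the two half-lattice spaces invariant
   (cmv_decoupled_split), so that its summands are its compressions. *)
Definition cmv_left (alpha : verblunsky) (k0 : int) (t : R) :
    ell2 R {k : int | k \in lhalf k0} -> ell2 R {k : int | k \in lhalf k0} :=
  compress (cmv (decoupled alpha k0 t)).
Definition cmv_right (alpha : verblunsky) (k0 : int) (t : R) :
    ell2 R {k : int | k \in rhalf k0} -> ell2 R {k : int | k \in rhalf k0} :=
  compress (cmv (decoupled alpha k0 t)).

Arguments cmv_left alpha k0 t _ : clear implicits.
Arguments cmv_right alpha k0 t _ : clear implicits.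

Definition cmv_split (alpha : verblunsky) (k0 : int) (t1 t2 : R) :
    ell2 R int -> ell2 R int :=
  dsum (cmv_left alpha k0 t1) (cmv_right alpha k0 t2).

Lemma rho_expi t : rho (expi t) = 0.
Proof.
by rewrite /rho /= sqr_sqrtr ?addr_ge0 ?sqr_ge0// cos2Dsin2 subrr sqrtr0.
Qed.

Lemma block_local_left b alpha k0 t (f g : int -> C) :
    (forall k, k <= k0 - 1 -> f k = g k) ->
  forall k, k <= k0 - 1 ->
    block_fun b (decoupled alpha k0 t) f k = block_fun b (decoupled alpha k0 t) g k.
Proof.
move=> fg k kk0; rewrite /block_fun; case: ifP => _.
  by rewrite !fg//; lia.
rewrite (fg k kk0); have [kE|kE] := eqVneq (k + 1) k0; last by rewrite (fg (k + 1))//; lia.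
by rewrite /= /set_coef kE eqxx !mxE/= rho_expi !mul0r.
Qed.

Lemma block_local_right b alpha k0 t (f g : int -> C) :
    (forall k, k0 <= k -> f k = g k) ->
  forall k, k0 <= k ->
    block_fun b (decoupled alpha k0 t) f k = block_fun b (decoupled alpha k0 t) g k.
Proof.
move=> fg k kk0; rewrite /block_fun; case: ifP => _; last first.
  by rewrite !fg//; lia.
rewrite (fg k kk0); have [kE|kE] := eqVneq k k0; last by rewrite (fg (k - 1))//; lia.
by rewrite /= /set_coef kE eqxx !mxE/= rho_expi !mul0r.
Qed.

Lemma ext0E (A : {pred int}) (f : ell2 R int) k :
  ext0 (restr A f) k = if k \in A then f k else 0.
Proof.
rewrite /= /ext0_fun; case: insubP => [k' kA <-|/negPf ->//].
by rewrite ifT// (valP k').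
Qed.

Theorem cmv_decoupled_split alpha k0 t :
  cmv (decoupled alpha k0 t) =1 cmv_split alpha k0 t t.
Proof.
move=> f; apply: ell2_eqP => k.
set D := decoupled alpha k0 t.
have -> : cmv_split alpha k0 t t f k =
    ext0 (restr (lhalf k0) (cmv D (ext0 (restr (lhalf k0) f)))) k +
    ext0 (restr (rhalf k0) (cmv D (ext0 (restr (rhalf k0) f)))) k by [].
rewrite !ext0E !unfold_in /lhalf /rhalf; have [kk0|kk0] := leP k0 k.
  rewrite ifF; last by lia.
  rewrite add0r; apply: block_local_right kk0 => {}k kk0; apply: block_local_right kk0 => {}k kk0.
  by rewrite [RHS]ext0E unfold_in /rhalf kk0.
have {}kk0 : k <= k0 - 1 by lia.
rewrite kk0 addr0; apply: block_local_left kk0 => {}k kk0; apply: block_local_left kk0 => {}k kk0.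
by rewrite [RHS]ext0E unfold_in /lhalf kk0.
Qed.

(* The value at 0 is a junk value. *)
Definition Arg (w : C) : R :=
  xget 0 [set theta | - pi < theta <= pi /\ w = `|w| * expi theta].

Lemma ArgP (w : C) : w != 0 -> - pi < Arg w <= pi /\ w = `|w| * expi (Arg w).
Proof.
move=> w0; rewrite /Arg; case: xgetP => [y _ //|nw]; exfalso.
case: w w0 nw => x y w0 nw.
have r0 : 0 < x ^+ 2 + y ^+ 2.
  rewrite lt_neqAle addr_ge0 ?sqr_ge0// andbT eq_sym paddr_eq0 ?sqr_ge0//.
  rewrite !sqrf_eq0; apply/negP => /andP[/eqP x0 /eqP y0].
  by move: w0; rewrite x0 y0 eqxx.
set r := Num.sqrt (x ^+ 2 + y ^+ 2).
have rp : 0 < r by rewrite sqrtr_gt0.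
have r2 : r ^+ 2 = x ^+ 2 + y ^+ 2 by rewrite sqr_sqrtr// ltW.
have xr : -1 <= x / r <= 1.
  by rewrite ler_pdivlMr// ler_pdivrMr//; nra.
have sE : sin (acos (x / r)) = `|y| / r.
  rewrite sin_acos// -[RHS]ger0_norm ?divr_ge0 ?normr_ge0 ?ltW// -sqrtr_sqr.
  congr Num.sqrt; rewrite !exprMn exprVn real_normK ?num_real// r2.
  by field; exact: lt0r_neq0.
have cE : cos (acos (x / r)) = x / r by rewrite acosK.
apply: (nw (if 0 <= y then acos (x / r) else - acos (x / r))); split.
  have := pi_gt0 R; have := acos_ge0 xr; have := acos_lepi xr.
  case: ifPn => [_|]; first lra.
  rewrite -ltNge => y0 _ ? ?; rewrite ltrN2 acos_ltpi//=; first lra.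
  by rewrite ltr_pdivlMr// ler_pdivrMr//; apply/andP; split; nra.
rewrite normc_def -/r /expi; case: ifPn => y0.
  rewrite cE sE ger0_norm//; simpc; congr Complex; field; exact: lt0r_neq0.
rewrite cosN sinN cE sE ler0_norm; last by lra.
simpc; congr Complex; field; exact: lt0r_neq0.
Qed.

Definition eqmod2pi (a b : R) := exists n : int, a = b + n%:~R * (2 * pi).

End CMV.

Section Operators.
Variables (K : fieldType) (V : lmodType K).
Implicit Types S T : V -> V.

Definition lin_indep n (e : 'I_n -> V) :=
  forall c : 'I_n -> K, \sum_i c i *: e i = 0 -> forall i, c i = 0.

Definition has_rank n T :=
  exists2 e : 'I_n -> V, lin_indep e &
    range T = [set v | exists c : 'I_n -> K, v = \sum_i c i *: e i].

Definition shift_op T (z : K) : V -> V := fun f => T f - z *: f.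

(* This is the inverse of T - z when T - z is bijective; the pseudo-inverse of
   the library otherwise. *)
Definition resolvent T (z : K) : V -> V := 'pinv_(fun=> 0) setT (shift_op T z).

End Operators.

(* Main.v *)
Require Import Defs.
From HB Require Import structures.
From mathcomp Require Import all_boot all_order all_algebra.
From mathcomp Require Import finmap.
From mathcomp Require Import all_classical all_reals all_analysis.
From mathcomp.real_closed Require Import complex.
From mathcomp Require Import ring lra zify.
Set Implicit Arguments.
Unset Strict Implicit.
Unset Printing Implicit Defensive.
Import Order.TTheory GRing.Theory Num.Theory.
Import numFieldNormedType.Exports.
Local Open Scope classical_set_scope.
Local Open Scope sesquilinear_scope.
Local Open Scope ring_scope.

(** Both operators have the same shape: a product of two block-diagonal maps
    with unitary 2 x 2 blocks, U with the blocks Theta_k and U12 with the block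
    Theta_k0 replaced by D = diag(- e^(i t1), e^(- i t2)) (cmv_splitE).

    Invertibility of U - z off the unit circle. A product of unitary block maps
    preserves the square sum and has an inverse of the same kind. According
    as |z| < 1 or |z| > 1, the equation U g - z g = f is rewritten as
    g = U^-1 f + z U^-1 g or as g = - z^-1 f + z^-1 U g, that is, as
    g = f' + w T g with T isometric and |w| < 1, which the Neumann series
    solves (contraction_solve). Since each coordinate of T g involves finitely
    many coordinates of g, the series only has to be summed coordinatewise,
    and the square sum of the limit is controlled by that of its partial sums.

    The rank. U and U12 share one of the two factors of their products, and
    the other factors differ by the single block X = Theta_k0 - D. Hence
    U - U12 is X acting on the coordinates k0 - 1 and k0, composed with
    bijections, and its rank is that of X (has_rank_cmv_mapB). From
    R_U - R_12 = - (U - z)^-1 (U - U12) (U12 - z)^-1 the resolvents have a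
    difference of the same rank (has_rank_resolventB).

    The criterion. With a = alpha_k0 and rho^2 = 1 - |a|^2 > 0, the off-diagonal
    entries of X do not vanish, so the rank is 1 or 2 according to whether
      det X = e^(i t1) (conj a - e^(- i t2)) - (1 - a e^(- i t2))
    vanishes. For w = i (a e^(- i t2 / 2) - e^(i t2 / 2)) one has
    e^(2 i Arg w) = w / conj w = (1 - a e^(- i t2)) / (conj a - e^(- i t2)),
    so det X = 0 says e^(i t1) = e^(2 i Arg w). If t1 = t2 = t then
    - det X = |e^(i t) - a|^2 + rho^2 > 0 and the rank is always 2. *)

(** * Rank and resolvents *)

Section LinearAlgebra.
Variable K : fieldType.

(** has_rank n T only depends on the range of T, and unfolds to span_dim of it;
    unlike has_rank this makes sense between different spaces. *)
Definition span_dim (V : lmodType K) n (S : set V) :=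
  exists2 e : 'I_n -> V, lin_indep e &
    S = [set v | exists c : 'I_n -> K, v = \sum_i c i *: e i].

Lemma linear_sumZ (V W : lmodType K) (A : V -> W) n (c : 'I_n -> K) e :
  linear A -> A (\sum_i c i *: e i) = \sum_i c i *: A (e i).
Proof.
move=> linA.
have A0 : A 0 = 0 by have := linA (-1) 0 0; rewrite addr0 !scaleN1r oppr0 addNr.
elim/big_rec2: _ => // i v w _ <-; exact: linA.
Qed.

(** A basis of the image is lifted through the injective map A. *)
Lemma span_dim_image (V W : lmodType K) (A : V -> W) n (S : set V) :
  linear A -> injective A -> span_dim n (A @` S) <-> span_dim n S.
Proof.
move=> linA injA.
have A0 : A 0 = 0 by have := linA (-1) 0 0; rewrite addr0 !scaleN1r oppr0 addNr.
split=> -[e inde Se].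
  have eS i : exists v, S v /\ A v = e i.
    have [v Sv ve] : (A @` S) (e i).
      rewrite Se; exists (fun j => (j == i)%:R).
      rewrite (bigD1 i)//= eqxx scale1r big1 ?addr0// => j /negPf ->.
      by rewrite scale0r.
    by exists v.
  have /choice[d dS] := eS.
  have Ad c : A (\sum_i c i *: d i) = \sum_i c i *: e i.
    by rewrite linear_sumZ//; apply: eq_bigr => i _; have [_ ->] := dS i.
  exists d => [c c0|]; first by apply: inde; rewrite -Ad c0.
  apply/seteqP; split=> [v Sv|v [c vc]].
    have : (A @` S) (A v) by exists v.
    by rewrite Se => -[c Av]; exists c; apply: injA; rewrite Ad.
  have [s Ss /injA <-//] : (A @` S) (A v).
  by rewrite Se; exists c; rewrite vc Ad.
exists (A \o e) => [c c0|].
  by apply: inde; apply: injA; rewrite linear_sumZ// A0.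
rewrite Se; apply/seteqP; split=> [_ [v [c ->] <-]|_ [c ->]].
  by exists c; rewrite linear_sumZ.
by exists (\sum_i c i *: e i); [exists c|rewrite linear_sumZ].
Qed.

(** A basis of the range is the same thing as a row-free matrix with the row space
    of X. *)
Lemma has_rank_mulmxr n m (X : 'M[K]_m) :
  has_rank n (fun v : 'rV[K]_m => v *m X) <-> \rank X = n.
Proof.
have spanE k (E : 'M[K]_(k, m)) :
    [set v | exists c : 'I_k -> K, v = \sum_i c i *: row i E] =
    [set v | (v <= E)%MS].
  apply/seteqP; split=> [_ [c ->]|v /submxP[w ->]] /=.
    by apply: summx_sub => i _; apply/scalemx_sub/row_sub.
  by exists (w 0); rewrite mulmx_sum_row.
have rangeE : range (fun v : 'rV[K]_m => v *m X) = [set v | (v <= X)%MS].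
  apply/seteqP; split=> [_ [v _ <-]|v /submxP[w ->]] /=; first exact: submxMl.
  by exists w.
have free k (E : 'M[K]_(k, m)) : lin_indep (fun i => row i E) <-> row_free E.
  split=> [inde|/row_free_inj injE c c0 i].
    apply: inj_row_free => w; rewrite mulmx_sum_row => /inde w0.
    by apply/rowP => i; rewrite w0 mxE.
  have : \row_i c i = 0.
    apply: injE; rewrite mul0mx mulmx_sum_row -[RHS]c0.
    by apply: eq_bigr => j _; rewrite mxE.
  by move=> /rowP/(_ i); rewrite !mxE.
have incl k (E : 'M[K]_(k, m)) :
    range (fun v : 'rV[K]_m => v *m X) = [set v : 'rV_m | (v <= E)%MS] <->
    (X :=: E)%MS.
  rewrite rangeE; split=> [XE|eXE].
    have XEv (v : 'rV[K]_m) : (v <= X)%MS = (v <= E)%MS :> Prop.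
      exact: (congr1 (fun S : set _ => S v) XE).
    by apply/eqmxP/andP; split; apply/rV_subP => v; rewrite XEv.
  by apply/seteqP; split=> v /=; rewrite eXE.
rewrite /has_rank; split=> [[e inde eX]|<-].
  have rowE : (fun i => row i (\matrix_i e i)) = e.
    by apply/funext => i; rewrite rowK.
  move: inde eX; rewrite -rowE spanE => /free + /incl eX.
  by rewrite /row_free eX => /eqP.
exists (fun i => row i (row_base X)); first exact/free/row_base_free.
by rewrite spanE; apply/incl/eqmx_sym/eq_row_base.
Qed.

Lemma resolventK (V : lmodType K) (T : V -> V) z :
  bijective (shift_op T z) ->
  cancel (resolvent T z) (shift_op T z) /\ cancel (shift_op T z) (resolvent T z).
Proof.
move=> [g gK Kg]; rewrite /resolvent; split=> x.
  by apply: pinvK; rewrite inE; exists (g x).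
apply: pinvKV; last by rewrite inE.
by move=> u v _ _; exact: can_inj gK _ _.
Qed.

Lemma shift_op_linear (V : lmodType K) (T : V -> V) z :
  linear T -> linear (shift_op T z).
Proof.
move=> linT a f g; rewrite /shift_op linT scalerDr opprD addrACA scalerBr.
by rewrite !scalerA mulrC.
Qed.

(** For f = S h - z h, the vector (T - z) (R_T f - R_S f) is
    (S h - z h) - (T h - z h) = S h - T h. Applying T - z rather than writing
    R_T (S - T) R_S avoids having to know that the resolvents are linear. *)
Lemma resolventB_range (V : lmodType K) (T S : V -> V) z :
  linear T -> bijective (shift_op T z) -> bijective (shift_op S z) ->
  (fun f => - shift_op T z f) @` range (resolvent T z \- resolvent S z) =
  range (T \- S).
Proof.
move=> linT /resolventK[TK _] /resolventK[SK KS].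
have key f : - shift_op T z ((resolvent T z \- resolvent S z) (shift_op S z f)) =
    (T \- S) f.
  rewrite /= KS (addrC (resolvent T z _)) -(scaleN1r f)
    (shift_op_linear z linT) TK scaleN1r.
  by rewrite opprD opprK opprB addrA subrK.
apply/seteqP; split=> [_ [_ [f _ <-] <-]|_ [f _ <-]].
  by rewrite -(SK f) key; exists (resolvent S z f).
by rewrite -key; eexists; [eexists|].
Qed.

Lemma has_rank_resolventB (V : lmodType K) (T S : V -> V) z n :
  linear T -> bijective (shift_op T z) -> bijective (shift_op S z) ->
  has_rank n (resolvent T z \- resolvent S z) <-> has_rank n (T \- S).
Proof.
move=> linT Tz Sz; rewrite /has_rank -(resolventB_range linT Tz Sz).
apply: iff_sym; apply: span_dim_image.
  by move=> a f g; rewrite shift_op_linear// opprD scalerN.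
by move=> f g /oppr_inj /(bij_inj Tz).
Qed.

(** An operator that acts by a 2 x 2 matrix between a surjection and an injection
    has the rank of this matrix. *)
Lemma has_rank_factor (V : lmodType K) (A : 'rV[K]_2 -> V) (p : V -> 'rV[K]_2)
    (X : 'M[K]_2) (T : V -> V) n :
  linear A -> injective A -> (forall v, exists f, p f = v) ->
  (forall f, T f = A (p f *m X)) -> has_rank n T <-> \rank X = n.
Proof.
move=> linA injA psurj TE; rewrite -has_rank_mulmxr /has_rank.
suff -> : range T = A @` range (fun v : 'rV[K]_2 => v *m X).
  exact: span_dim_image.
apply/seteqP; split=> [_ [f _ <-]|_ [_ [v _ <-] <-]].
  by rewrite TE; exists (p f *m X) => //; exists (p f).
by have [f <-] := psurj v; rewrite -TE; exists f.
Qed.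

Lemma rank_mx22 (X : 'M[K]_2) : X != 0 ->
  (\rank X = 1 <-> \det X = 0) /\ (\det X <> 0 -> \rank X = 2).
Proof.
rewrite -mxrank_eq0 => X0.
have full : (\rank X == 2) = (\det X != 0).
  by rewrite -[LHS]/(row_free X) row_free_unit unitmxE unitfE.
have := rank_leq_row X; move: full X0.
have [d0|/eqP d0] := eqVneq (\det X) 0; case: (\rank X) => [|[|[|]]]//= full _ _.
Qed.

Lemma det_mx22 (X : 'M[K]_2) : \det X = X 0 0 * X 1 1 - X 0 1 * X 1 0.
Proof.
rewrite (expand_det_row _ 0) big_ord_recl big_ord1 /cofactor !det_mx11 !mxE /=.
rewrite expr0 expr1 mul1r mulN1r mulrN.
by congr (_ * X _ _ - X _ _ * X _ _); apply/val_inj.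
Qed.

End LinearAlgebra.

(** * Square sums and coordinatewise limits *)

Section Energy.
Variables (R : realType) (I : choiceType).
Implicit Types (f g : I -> R[i]) (x y : R[i]).

Definition sqn x : R := complex.Re x ^+ 2 + complex.Im x ^+ 2.

Lemma sqn_ge0 x : 0 <= sqn x.
Proof. by rewrite addr_ge0 ?sqr_ge0. Qed.

Lemma sqnE x : Normc.normc x ^+ 2 = sqn x.
Proof. by case: x => a b /=; rewrite sqr_sqrtr ?addr_ge0 ?sqr_ge0. Qed.

Lemma sqnM x y : sqn (x * y) = sqn x * sqn y.
Proof. by case: x y => [a b] [c d]; rewrite /sqn /=; ring. Qed.

Lemma sqnX x n : sqn (x ^+ n) = sqn x ^+ n.
Proof.
elim: n => [|n IHn]; first by rewrite !expr0 /sqn /= expr1n expr0n addr0.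
by rewrite !exprS sqnM IHn.
Qed.

Lemma sqn_eq0 x : sqn x = 0 -> x = 0.
Proof.
case: x => a b /eqP; rewrite paddr_eq0 ?sqr_ge0// !sqrf_eq0 /=.
by move=> /andP[/eqP -> /eqP ->].
Qed.

Lemma sqnC x : (sqn x)%:C%C = x * x^*.
Proof. by case: x => a b; rewrite /sqn /=; simpc; congr Complex; ring. Qed.

(** Convexity of the square modulus at x + w y = (1 - r) (x / (1 - r)) + r (w y / r).
    This makes the square sums of the partial sums of the Neumann series satisfy
    a recursion e' <= e / (1 - r) + r e', with the bound e / (1 - r)^2. *)
Lemma sqn_convex (r : R) w x y : 0 <= r < 1 -> sqn w = r ^+ 2 ->
  sqn (x + w * y) <= (1 - r)^-1 * sqn x + r * sqn y.
Proof.
move=> /andP[r0 r1] wr; have q0 : 0 < 1 - r by lra.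
have [r00|rn0] := eqVneq r 0.
  have -> : w = 0 by apply: sqn_eq0; rewrite wr r00 expr0n.
  by rewrite mul0r addr0 r00 subr0 invr1 mul1r mul0r addr0.
have rp : 0 < r by rewrite lt_neqAle eq_sym rn0.
(* Multiplied by r (1 - r), the difference of the two sides is a square. *)
rewrite -(ler_pM2l (mulr_gt0 rp q0)) -subr_ge0.
suff -> : r * (1 - r) * ((1 - r)^-1 * sqn x + r * sqn y) -
    r * (1 - r) * sqn (x + w * y) =
    sqn (r%:C%C * x - (1 - r)%:C%C * (w * y)) by exact: sqn_ge0.
have -> : r * (1 - r) * ((1 - r)^-1 * sqn x + r * sqn y) =
    r * sqn x + (1 - r) * sqn (w * y).
  by rewrite sqnM wr; field; rewrite lt0r_neq0.
case: x (w * y) => [a b] [c d]; rewrite /sqn /=; ring.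
Qed.

(** The square of the l^2 norm, in the extended reals so that it is defined for
    every family. *)
Definition energy f : \bar R := \esum_(k in [set: I]) (sqn (f k))%:E.

Lemma energy_ge0 f : (0 <= energy f)%E.
Proof. by apply: esum_ge0 => k _; rewrite lee_fin sqn_ge0. Qed.

Lemma energyE f :
  energy f = \esum_(k in [set: I]) `|(Normc.normc (f k) ^+ 2)%:E|%E.
Proof. by apply: eq_esum => k _; rewrite sqnE gee0_abs// lee_fin sqn_ge0. Qed.

Lemma energy_summable f : (energy f < +oo)%E -> sqr_summable f.
Proof. by rewrite energyE. Qed.

Lemma ell2_energy (f : ell2 R I) : (energy f < +oo)%E.
Proof. by rewrite energyE; exact: ell2P. Qed.

Lemma sqn_le_energy f k : ((sqn (f k))%:E <= energy f)%E.
Proof.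
apply: esum_ge; exists [set k]; first by split.
by rewrite fsbig_set1.
Qed.

Lemma energy0 f : energy f = 0%E -> f = fun=> 0.
Proof.
move=> f0; apply/funext => k; apply: sqn_eq0; apply/eqP; rewrite eq_le sqn_ge0 andbT.
by rewrite -lee_fin; have := sqn_le_energy f k; rewrite f0.
Qed.

Lemma energy_le_lin f g h (a b : R) : 0 <= a -> 0 <= b ->
  (forall k, sqn (h k) <= a * sqn (f k) + b * sqn (g k)) ->
  (energy h <= a%:E * energy f + b%:E * energy g)%E.
Proof.
move=> a0 b0 hfg; apply: ge_ereal_sup => _ [A [finA _] <-].
have le_sub (F : I -> R[i]) : ((\sum_(k <- fset_set A) sqn (F k))%:E <= energy F)%E.
  by apply: esum_ge; exists A; rewrite ?fsbig_finite//= sumEFin.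
rewrite fsbig_finite//= sumEFin.
apply: (@le_trans _ _ (a%:E * (\sum_(k <- fset_set A) sqn (f k))%:E +
    b%:E * (\sum_(k <- fset_set A) sqn (g k))%:E)%E).
  by rewrite lee_fin !mulr_sumr -big_split; apply: ler_sum => k _; exact: hfg.
by apply: leeD; apply: lee_wpmul2l; rewrite ?lee_fin.
Qed.

Lemma energyZ_fin f (c : R[i]) : (energy f < +oo)%E -> (energy (c *: f) < +oo)%E.
Proof.
move=> foo.
have /le_lt_trans : (energy (c *: f) <= (sqn c)%:E * energy f + 0%:E * energy f)%E.
  by apply: energy_le_lin => [||k]; rewrite ?sqn_ge0// -sqnM mul0r addr0.
apply; have : energy f \is a fin_num by rewrite ge0_fin_numE ?energy_ge0.
by move=> /fineK <-; rewrite -!EFinM -EFinD ltry.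
Qed.

End Energy.

Section CvgC.
Variable R : realType.
Implicit Types (u v : nat -> R[i]).

(** Convergence in C through real and imaginary parts, which reduces completeness
    of C to that of R. *)
Definition cvgc u (l : R[i]) :=
  (fun n => complex.Re (u n)) @ \oo --> complex.Re l /\
  (fun n => complex.Im (u n)) @ \oo --> complex.Im l.

Lemma cvgc_cst c : cvgc (fun=> c) c.
Proof. by split; exact: cvg_cst. Qed.

Lemma cvgcS u l : cvgc u l -> cvgc (fun n => u n.+1) l.
Proof.
move=> [ul ul']; split.
  by rewrite (cvg_shiftS (fun n => complex.Re (u n))).
by rewrite (cvg_shiftS (fun n => complex.Im (u n))).
Qed.

Lemma cvgcD u v a b : cvgc u a -> cvgc v b -> cvgc (fun n => u n + v n) (a + b).
Proof.
move=> [ua ua'] [vb vb']; split; rewrite raddfD/=.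
  by under eq_fun do rewrite raddfD/=; exact: cvgD.
by under eq_fun do rewrite raddfD/=; exact: cvgD.
Qed.

Lemma cvgcZ u c a : cvgc u a -> cvgc (fun n => c * u n) (c * a).
Proof.
have ReM (x y : R[i]) : complex.Re (x * y) =
    complex.Re x * complex.Re y - complex.Im x * complex.Im y.
  by case: x y => [? ?] [].
have ImM (x y : R[i]) : complex.Im (x * y) =
    complex.Re x * complex.Im y + complex.Im x * complex.Re y.
  by case: x y => [? ?] [].
move=> [ua ua']; split.
  rewrite ReM; under eq_fun do rewrite ReM.
  by apply: cvgB; apply: cvgMr.
rewrite ImM; under eq_fun do rewrite ImM.
by apply: cvgD; apply: cvgMr.
Qed.

Lemma cvgc_unique u a b : cvgc u a -> cvgc u b -> a = b.
Proof.
case: a b => [a a'] [b b'] [/= ua ua'] [/= ub ub'].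
by congr Complex; [exact: cvg_unique ua ub|exact: cvg_unique ua' ub'].
Qed.

Lemma cvg_sqn u a : cvgc u a -> (fun n => sqn (u n)) @ \oo --> sqn a.
Proof.
move=> [ua ua']; rewrite /sqn; under eq_fun do rewrite !expr2; rewrite !expr2.
by apply: cvgD; apply: cvgM.
Qed.

Lemma cvgc_series u (B r : R) : 0 <= r < 1 ->
  (forall n, sqn (u n) <= (B * r ^+ n) ^+ 2) ->
  exists l, cvgc (fun n => \sum_(i < n) u i) l.
Proof.
move=> /andP[r0 r1] uB.
have cvg_abs (v : nat -> R) : (forall n, v n ^+ 2 <= (B * r ^+ n) ^+ 2) ->
    cvgn (series v).
  move=> vB; apply: normed_cvg.
  apply: (@series_le_cvg _ _ (geometric `|B| r)) => [n|n|n|] //=.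
  - by rewrite mulr_ge0// exprn_ge0.
  - rewrite -[X in _ * X]ger0_norm ?exprn_ge0// -normrM.
    by rewrite -[leLHS]sqrtr_sqr -[leRHS]sqrtr_sqr ler_wsqrtr.
  - by apply: is_cvg_geometric_series; rewrite ger0_norm.
have ReP : cvgn (series (fun i => complex.Re (u i))).
  by apply: cvg_abs => n; apply: le_trans (uB n); rewrite lerDl sqr_ge0.
have ImP : cvgn (series (fun i => complex.Im (u i))).
  by apply: cvg_abs => n; apply: le_trans (uB n); rewrite lerDr sqr_ge0.
exists (Complex (limn (series (fun i => complex.Re (u i))))
  (limn (series (fun i => complex.Im (u i))))).
split.
  under eq_fun => n do rewrite raddf_sum -(big_mkord xpredT (fun i => complex.Re (u i))).
  exact: ReP.
under eq_fun => n do rewrite raddf_sum -(big_mkord xpredT (fun i => complex.Im (u i))).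
exact: ImP.
Qed.

(** Fatou's lemma for sums, by passing to the limit in finite partial sums. *)
Lemma energy_lim (I : choiceType) (F : nat -> I -> R[i]) (f : I -> R[i]) (B : R) :
  (forall k, cvgc (F^~ k) (f k)) -> (forall n, (energy (F n) <= B%:E)%E) ->
  (energy f <= B%:E)%E.
Proof.
move=> Ff FB; apply: ge_ereal_sup => _ [A [finA _] <-].
rewrite fsbig_finite//= sumEFin lee_fin.
have cvgS (s : seq I) :
    (fun n => \sum_(k <- s) sqn (F n k)) @ \oo --> \sum_(k <- s) sqn (f k).
  elim: s => [|k s IHs].
    by rewrite big_nil; under eq_fun do rewrite big_nil; exact: cvg_cst.
  rewrite big_cons; under eq_fun do rewrite big_cons.
  by apply: cvgD => //; exact: cvg_sqn.
apply: (closed_cvg _ (@closed_le _ B)) (cvgS _).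
apply: nearW => n /=; rewrite -lee_fin; apply: le_trans (FB n).
by apply: esum_ge; exists A; rewrite ?fsbig_finite//= sumEFin.
Qed.
End CvgC.

(** * The Neumann series *)

Section Contraction.
Variables (R : realType) (I : choiceType).
Variable T : {linear (I -> R[i]) -> (I -> R[i])}.
Hypothesis T_energy : forall f, energy (T f) = energy f.
Hypothesis T_cvg : forall (F : nat -> I -> R[i]) f,
  (forall k, cvgc (F^~ k) (f k)) -> forall k, cvgc (fun n => T (F n) k) (T f k).
Variables (w : R[i]) (r : R).
Hypothesis (r01 : 0 <= r < 1) (sqn_w : sqn w = r ^+ 2).

(** The square sum of f is finite and equals |w|^2 times itself. *)
Lemma contraction_fixed_eq0 f : (energy f < +oo)%E -> f = w *: T f -> f = 0.
Proof.
move=> foo fE; apply: energy0; have f0 := energy_ge0 f.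
have /fineK Ef : energy f \is a fin_num by rewrite ge0_fin_numE.
have : (energy f <= (r ^+ 2)%:E * energy (T f) + 0%:E * energy f)%E.
  apply: energy_le_lin => [||k]; rewrite ?sqr_ge0//.
  by rewrite {1}fE sqnM sqn_w mul0r addr0.
move: f0; rewrite T_energy -Ef -!EFinM -EFinD !lee_fin => e0 le_e.
case/andP: r01 => r0 r1; have r2 : r ^+ 2 < 1 by rewrite expr_lt1.
by congr EFin; nra.
Qed.

(** The solution is the coordinatewise sum g of the series w^i T^i f. Each
    coordinate of T^i f is bounded by the norm of f, so the series is dominated
    by a geometric one; T commutes with coordinatewise limits by T_cvg. *)
Lemma contraction_solve f : (energy f < +oo)%E ->
  exists2 g, (energy g < +oo)%E & g = f + w *: T g.
Proof.
move=> foo; case/andP: (r01) => r0 r1.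
have q0 : 0 < 1 - r by lra.
have /fineK Ef : energy f \is a fin_num by rewrite ge0_fin_numE ?energy_ge0.
set E := fine (energy f) in Ef.
have E0 : 0 <= E by rewrite -lee_fin Ef energy_ge0.
pose S n := \sum_(i < n) w ^+ i *: iter i T f.
have SS n : S n.+1 = f + w *: T (S n).
  rewrite /S big_ord_recl expr0 scale1r linear_sum scaler_sumr; congr (_ + _).
  by apply: eq_bigr => i _; rewrite linearZ scalerA -exprS.
have iter_energy i : energy (iter i T f) = energy f.
  by elim: i => //= i IHi; rewrite T_energy.
(* E / (1 - r)^2 is the fixed point of the recursion given by sqn_convex. *)
have S_energy n : (energy (S n) <= (E / (1 - r) ^+ 2)%:E)%E.
  elim: n => [|n IHn].
    rewrite /S big_ord0 /energy esum1; first by rewrite lee_fin divr_ge0 ?sqr_ge0.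
    by move=> k _; rewrite /sqn /= expr0n addr0.
  apply: (@le_trans _ _ ((1 - r)^-1%:E * energy f + r%:E * energy (T (S n)))%E).
    apply: energy_le_lin => [||k]//; first by rewrite invr_ge0 ltW.
    by rewrite SS; exact: sqn_convex.
  rewrite T_energy -Ef; apply: le_trans (leeD (lexx _) (lee_wpmul2l _ IHn)) _ => //.
  rewrite -!EFinM -EFinD lee_fin le_eqVlt; apply/orP; left; apply/eqP.
  by field; exact: lt0r_neq0.
have /choice[g Sg] : forall k, exists l, cvgc (fun n => S n k) l.
  move=> k.
  have [||l Sl] := @cvgc_series _ (fun i => w ^+ i * iter i T f k) (Num.sqrt E) r => //.
    move=> n; rewrite sqnM sqnX sqn_w exprAC exprMn sqr_sqrtr// mulrC.
    apply: ler_wpM2r; first exact: sqr_ge0.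
    by rewrite -lee_fin Ef -(iter_energy n) sqn_le_energy.
  exists l; rewrite /S; under eq_fun do rewrite fct_sumE; exact: Sl.
exists g; first exact: le_lt_trans (energy_lim Sg S_energy) (ltry _).
apply/funext => k; apply: (@cvgc_unique _ (fun n => S n.+1 k)).
  exact: (@cvgcS _ (fun n => S n k)) (Sg k).
under eq_fun do rewrite SS.
by apply: cvgcD; [exact: cvgc_cst|apply: cvgcZ; exact: T_cvg].
Qed.

End Contraction.

(** * Operators with unitary 2 x 2 blocks *)

Lemma sum_ord2 (V : nmodType) (F : 'I_2 -> V) : \sum_i F i = F 0 + F 1.
Proof. by rewrite big_ord_recl big_ord1; congr (_ + F _); apply/val_inj. Qed.

Section Blocks.
Variable R : realType.
Local Notation C := R[i].
Implicit Types (b : bool) (M : int -> 'M[C]_2) (f g : int -> C) (k : int).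

(** block_fun with arbitrary blocks in place of Theta alpha_k. This is needed because
    the block diag(- e^(i t1), e^(- i t2)) of the split operator is not of the form
    Theta a when e^(i t1) and e^(i t2) differ. *)
Definition block_map b M f k : C :=
  if oddz k == b then M k 1 0 * f (k - 1) + M k 1 1 * f k
  else M (k + 1) 0 0 * f k + M (k + 1) 0 1 * f (k + 1).

Lemma block_map_linear b M : linear (block_map b M).
Proof.
move=> a f g; apply/funext => k.
have E (u v : int -> C) j : (a *: u + v) j = a * u j + v j by [].
rewrite E /block_map !E; case: ifP => _; ring.
Qed.

HB.instance Definition _ b M :=
  GRing.isLinear.Build C (int -> C) (int -> C) *:%R (block_map b M)
    (block_map_linear b M).

Lemma block_map_cvg b M (F : nat -> int -> C) f :
  (forall k, cvgc (F^~ k) (f k)) ->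
  forall k, cvgc (fun n => block_map b M (F n) k) (block_map b M f k).
Proof.
by move=> Ff k; rewrite /block_map; case: ifP => _; apply: cvgcD; apply: cvgcZ.
Qed.

Lemma unitary_col (A : 'M[C]_2) (i j : 'I_2) : A \is unitarymx ->
  (A 0 i)^* * A 0 j + (A 1 i)^* * A 1 j = (i == j)%:R.
Proof.
move=> /unitarymxP/mulmx1C/matrixP/(_ i j).
by rewrite !mxE sum_ord2 !mxE.
Qed.

Lemma unitary_sqn (A : 'M[C]_2) x y : A \is unitarymx ->
  sqn (A 0 0 * x + A 0 1 * y) + sqn (A 1 0 * x + A 1 1 * y) = sqn x + sqn y.
Proof.
move=> uA; have sqn2C (u v : C) : (sqn u + sqn v)%:C%C = u * u^* + v * v^*.
  by case: u v => [? ?] [? ?]; rewrite /sqn; simpc; congr Complex; ring.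
apply: (@complexI R); rewrite !sqn2C !rmorphD !rmorphM.
have e00 := unitary_col 0 0 uA; have e01 := unitary_col 0 1 uA.
have e10 := unitary_col 1 0 uA; have e11 := unitary_col 1 1 uA.
transitivity (((A 0 0)^* * A 0 0 + (A 1 0)^* * A 1 0) * (x * x^*) +
   ((A 0 0)^* * A 0 1 + (A 1 0)^* * A 1 1) * (x^* * y) +
   ((A 0 1)^* * A 0 0 + (A 1 1)^* * A 1 0) * (x * y^*) +
   ((A 0 1)^* * A 0 1 + (A 1 1)^* * A 1 1) * (y * y^*)); first by ring.
by rewrite e00 e01 e10 e11 /= !mul1r !mul0r !addr0.
Qed.

Lemma energy_partner b f : energy (f \o partner b) = energy f.
Proof.
rewrite /energy [RHS](@reindex_esum _ _ _ setT setT (partner b))//.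
split=> // [x y _ _ /(can_inj (@partnerK b))//|x _].
by exists (partner b x); rewrite // partnerK.
Qed.

(** The positions k and partner b k carry one block, so that
    |Bf k|^2 + |Bf (partner k)|^2 = |f k|^2 + |f (partner k)|^2; summing over k
    counts every block twice on both sides. *)
Lemma block_map_energy b M f : (forall k, M k \is unitarymx) ->
  energy (block_map b M f) = energy f.
Proof.
move=> uM.
have dbl g : (energy g + energy g = energy g + energy (g \o partner b))%E.
  by rewrite energy_partner.
have pairE k : sqn (block_map b M f k) + sqn (block_map b M f (partner b k)) =
    sqn (f k) + sqn (f (partner b k)).
  have neqb (c d : bool) : (~~ c == d) = (c != d) by case: c d => [] [].
  rewrite /block_map /partner; have [kb|kb] := ifPn (oddz k == b).
    by rewrite oddzB neqb kb /= subrK addrC unitary_sqn// addrC.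
  by rewrite oddzS neqb kb /= addrK unitary_sqn.
have : (energy (block_map b M f) + energy (block_map b M f) = energy f + energy f)%E.
  rewrite !dbl /energy -!esumD; try by move=> k _; rewrite lee_fin sqn_ge0.
  by apply: eq_esum => k _; rewrite -!EFinD pairE.
have := energy_ge0 f; have := energy_ge0 (block_map b M f).
case: (energy f) (energy (block_map b M f)) => [x| |] [y| |]//= _ _ [] xy.
by congr EFin; lra.
Qed.

Lemma block_mapK b M M' f : (forall k, M k *m M' k = 1%:M) ->
  block_map b M (block_map b M' f) = f.
Proof.
move=> MM; apply/funext => k.
have E i j l : M l i 0 * M' l 0 j + M l i 1 * M' l 1 j = (i == j)%:R.
  by have /matrixP/(_ i j) := MM l; rewrite !mxE sum_ord2.
have neqb (c d : bool) : (~~ c == d) = (c != d) by case: c d => [] [].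
rewrite {1}/block_map; case: ifPn => kb.
  rewrite /block_map kb oddzB neqb kb /= subrK.
  transitivity ((M k 1 0 * M' k 0 0 + M k 1 1 * M' k 1 0) * f (k - 1) +
    (M k 1 0 * M' k 0 1 + M k 1 1 * M' k 1 1) * f k); first by ring.
  by rewrite !E /= mul0r mul1r add0r.
rewrite /block_map (negPf kb) oddzS neqb kb /= addrK; set l := k + 1.
transitivity ((M l 0 0 * M' l 0 0 + M l 0 1 * M' l 1 0) * f k +
    (M l 0 0 * M' l 0 1 + M l 0 1 * M' l 1 1) * f l); first by ring.
by rewrite !E /= mul0r mul1r addr0.
Qed.

Lemma block_map_eq b M M' : (forall k, oddz k = b -> M k = M' k) ->
  block_map b M = block_map b M'.
Proof.
move=> MM; apply/funext => f; apply/funext => k; rewrite /block_map.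
case: ifPn => kb; first by rewrite MM//; exact/eqP.
by rewrite MM//; rewrite oddzS; case: b (oddz k) kb {MM} => -[].
Qed.

Definition cmv_map M : (int -> C) -> int -> C := block_map false M \o block_map true M.
HB.instance Definition _ M := GRing.Linear.on (cmv_map M).

Definition cmv_map_inv M : (int -> C) -> int -> C :=
  block_map true (fun k => (M k)^t*) \o block_map false (fun k => (M k)^t*).
HB.instance Definition _ M := GRing.Linear.on (cmv_map_inv M).

End Blocks.

Section Unitary.
Variable R : realType.
Local Notation C := R[i].
Variable M : int -> 'M[C]_2.
Hypothesis uM : forall k, M k \is unitarymx.
Implicit Types (f g : int -> C).

Let uM' k : (M k)^t* \is unitarymx.
Proof. by rewrite trmxC_unitary. Qed.

Lemma cmv_mapK f : cmv_map M (cmv_map_inv M f) = f.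
Proof. by rewrite /cmv_map /cmv_map_inv /= !block_mapK// => k; exact/unitarymxP. Qed.

Lemma cmv_map_energy f : energy (cmv_map M f) = energy f.
Proof. by rewrite /cmv_map /= !block_map_energy. Qed.

Lemma cmv_map_inv_energy f : energy (cmv_map_inv M f) = energy f.
Proof. by rewrite /cmv_map_inv /= !block_map_energy. Qed.

Lemma cmv_map_cvg (F : nat -> int -> C) f : (forall k, cvgc (F^~ k) (f k)) ->
  forall k, cvgc (fun n => cmv_map M (F n) k) (cmv_map M f k).
Proof. by move=> Ff; do 2!apply: block_map_cvg. Qed.

Lemma cmv_map_inv_cvg (F : nat -> int -> C) f : (forall k, cvgc (F^~ k) (f k)) ->
  forall k, cvgc (fun n => cmv_map_inv M (F n) k) (cmv_map_inv M f k).
Proof. by move=> Ff; do 2!apply: block_map_cvg. Qed.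

Lemma cmv_mapVK f : cmv_map_inv M (cmv_map M f) = f.
Proof.
by rewrite /cmv_map /cmv_map_inv /= !block_mapK// => k; apply/mulmx1C/unitarymxP.
Qed.

(** Off the unit circle either z or z^-1 is a strict contraction factor;
    this alternative selects which of U^-1 and U to iterate. *)
Lemma normC_neq1P z : `|z| != 1 ->
  (exists2 r : R, 0 <= r < 1 & sqn z = r ^+ 2) \/
  z != 0 /\ (exists2 r : R, 0 <= r < 1 & sqn z^-1 = r ^+ 2).
Proof.
have -> : `|z| = (Normc.normc z)%:C%C by case: z.
set r := Normc.normc z => r1.
have r0 : 0 <= r by rewrite /r; case: (z) => x y; exact: sqrtr_ge0.
have zr : sqn z = r ^+ 2 by rewrite sqnE.
have {}r1 : r != 1 by apply: contra_neq r1 => ->.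
have [rlt|rge] := ltP r 1; first by left; exists r; rewrite ?r0.
have rgt : 1 < r by rewrite lt_neqAle eq_sym r1.
have z0 : z != 0.
  apply/eqP => z0; move: zr; rewrite z0 /sqn /= expr0n addr0 => /eqP.
  by rewrite eq_sym sqrf_eq0 => /eqP re; move: rge; rewrite re ler10.
right; split=> //; exists r^-1; first by rewrite invr_ge0 r0 invf_lt1// (lt_trans ltr01).
have : sqn z * sqn z^-1 = 1 by rewrite -sqnM divff// /sqn /= expr1n expr0n addr0.
rewrite zr => zz; rewrite exprVn; apply: (mulfI (_ : r ^+ 2 != 0)).
  by rewrite sqrf_eq0 gt_eqF// (lt_trans ltr01).
by rewrite zz divff// sqrf_eq0 gt_eqF// (lt_trans ltr01).
Qed.

Lemma cmv_map_shift_inj z f : `|z| != 1 -> (energy f < +oo)%E ->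
  cmv_map M f = z *: f -> f = 0.
Proof.
move=> /normC_neq1P[[r r01 zr]|[z0 [r r01 zr]]] foo fz.
  apply: (contraction_fixed_eq0 cmv_map_inv_energy r01 zr foo).
  by rewrite -linearZ -fz [RHS]cmv_mapVK.
apply: (contraction_fixed_eq0 cmv_map_energy r01 zr foo).
by rewrite -[RHS]/(z^-1 *: cmv_map M f) fz scalerA mulVf// scale1r.
Qed.

Lemma cmv_map_shift_surj z f : `|z| != 1 -> (energy f < +oo)%E ->
  exists2 g, (energy g < +oo)%E & cmv_map M g - z *: g = f.
Proof.
move=> /normC_neq1P[[r r01 zr]|[z0 [r r01 zr]]] foo.
  have [|g goo gE] := contraction_solve cmv_map_inv_energy cmv_map_inv_cvg r01 zr
    (f := cmv_map_inv M f); first by rewrite cmv_map_inv_energy.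
  by exists g => //; rewrite {1}gE linearD linearZ /= !cmv_mapK addrK.
have [|g goo gE] := contraction_solve cmv_map_energy cmv_map_cvg r01 zr
    (f := - z^-1 *: f); first exact: energyZ_fin.
exists g => //; rewrite [X in z *: X]gE scalerDr !scalerA mulrN mulfV//.
by rewrite scaleN1r scale1r opprD opprK addrC subrK.
Qed.

Lemma cmv_map_shift_bij (T : ell2 R int -> ell2 R int) z :
  (forall f : ell2 R int, T f = cmv_map M f :> (int -> C)) -> `|z| != 1 ->
  bijective (shift_op T z).
Proof.
move=> TE z1.
have shE (f : ell2 R int) :
    shift_op T z f = cmv_map M f - z *: (f : int -> C) :> (int -> C).
  by rewrite -TE.
have surj (g : ell2 R int) : exists h, shift_op T z h = g.
  have [f /energy_summable sf fE] := cmv_map_shift_surj z1 (ell2_energy g).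
  by exists (MkEll2 sf); apply/val_inj; apply: etrans fE; exact: (shE (MkEll2 sf)).
have inj : injective (shift_op T z : ell2 R int -> _).
  move=> f g fg; apply/eqP; rewrite -subr_eq0; apply/eqP/val_inj.
  apply: (cmv_map_shift_inj z1 (ell2_energy (f - g))).
  change (cmv_map M ((f : int -> C) - g) = z *: ((f : int -> C) - g)).
  rewrite scalerBr (_ : cmv_map M _ = cmv_map M f - cmv_map M g); last exact: linearB.
  have := congr1 (@l2val R int) fg; rewrite !shE => /eqP.
  by rewrite subr_eq => /eqP ->; rewrite addrAC (addrAC (cmv_map M g)) subrr add0r addrC.
have /choice[h hK] := surj; exists h => // y; apply: inj; exact: hK.
Qed.
End Unitary.

(** * Changing one block *)

Section Lattice.
Variable R : realType.
Local Notation C := R[i].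
Implicit Types (M : int -> 'M[C]_2) (f : ell2 R int) (k : int).

Lemma block_map_summable b M (uM : forall k, M k \is unitarymx) f :
  sqr_summable (block_map b M f).
Proof. by apply: energy_summable; rewrite block_map_energy//; exact: ell2_energy. Qed.

Lemma delta_summable k : sqr_summable (fun j : int => (j == k)%:R : C).
Proof.
apply: energy_summable; rewrite /energy.
have -> : \esum_(j in [set: int]) (sqn ((j == k)%:R : C))%:E =
    \esum_(j in [set k]) (1 : R)%:E.
  rewrite [RHS]esum_mkcond; apply: eq_esum => j _; rewrite /sqn /=.
  case: (eqVneq j k) => [->|jk]; first by rewrite mem_set//= expr1n expr0n addr0.
  by rewrite memNset//= ?expr0n ?addr0//; exact/eqP.
by rewrite esum_set1 ?ltry// lee_fin.
Qed.

(** The plane of the coordinates k - 1 and k, on which the block number k acts. *)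
Definition embed2 k (v : 'rV[C]_2) : ell2 R int :=
  v 0 0 *: MkEll2 (delta_summable (k - 1)) + v 0 1 *: MkEll2 (delta_summable k).

Definition proj2 k f : 'rV[C]_2 := \row_j (if j == 0 then f (k - 1) else f k).

Lemma embed2E k v j : embed2 k v j =
  if j == k - 1 then v 0 0 else if j == k then v 0 1 else 0.
Proof.
rewrite ell2DE !ell2ZE /=; have [->|jk1] := eqVneq j (k - 1).
  by rewrite (_ : (k - 1 == k) = false) ?mulr1 ?mulr0 ?addr0//; apply/eqP; lia.
by rewrite mulr0 add0r; case: eqVneq; rewrite ?mulr1 ?mulr0.
Qed.

Lemma embed2_linear k : linear (embed2 k).
Proof.
move=> a u v; apply: ell2_eqP => j; rewrite [RHS]ell2DE [in RHS]ell2ZE !embed2E !mxE.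
by case: ifP => // _; case: ifP => // _; rewrite mulr0 addr0.
Qed.

Lemma proj2_embed2 k v : proj2 k (embed2 k v) = v.
Proof.
apply/rowP => j; rewrite mxE !embed2E eqxx.
have -> : (k == k - 1) = false by apply/eqP; lia.
by rewrite eqxx; case: ifPn => [/eqP ->//|j0]; congr (v _ _);
  apply/val_inj; case: j j0 => [[|[|]]].
Qed.

Lemma embed2_inj k : injective (embed2 k).
Proof. exact: can_inj (proj2_embed2 k). Qed.

(** Row vectors are multiplied on the right, hence the transpose. *)
Lemma block_mapB M M' k0 f : (forall k, k != k0 -> M k = M' k) ->
  forall k, block_map (oddz k0) M f k - block_map (oddz k0) M' f k =
    embed2 k0 (proj2 k0 f *m (M k0 - M' k0)^T) k.
Proof.
move=> MM k; rewrite embed2E !mxE !sum_ord2 !mxE /=.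
rewrite /block_map; have [->|kk1] := eqVneq k (k0 - 1).
  rewrite oddzB (_ : (~~ oddz k0 == oddz k0) = false); last by case: oddz.
  by rewrite subrK; ring.
have [->|kk0] := eqVneq k k0; first by rewrite eqxx; ring.
case: ifP => _; first by rewrite MM// subrr.
by rewrite MM ?subrr//; apply/eqP => kE; move: kk1; rewrite -kE addrK eqxx.
Qed.

(** Only the factor whose blocks have the parity of k0 changes. For odd k0 this is
    the right factor, and the difference is the local one followed by the common
    left factor; for even k0 it is the left factor, and the common right factor
    comes first. *)
Lemma has_rank_cmv_mapB M M' k0 (T T' : ell2 R int -> ell2 R int) n :
  (forall k, M k \is unitarymx) -> (forall k, M' k \is unitarymx) ->
  (forall k, k != k0 -> M k = M' k) ->
  (forall f, T f = cmv_map M f :> (int -> C)) ->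
  (forall f, T' f = cmv_map M' f :> (int -> C)) ->
  has_rank n (T \- T') <-> \rank (M k0 - M' k0) = n.
Proof.
move=> uM uM' MM TE TE'.
pose B b f := MkEll2 (block_map_summable b uM f).
have MMn b : b != oddz k0 -> block_map b M = block_map b M'.
  by move=> bk0; apply: block_map_eq => k kb; apply: MM; apply: contra_neq bk0 => <-.
have adj k : M k *m (M k)^t* = 1%:M by exact/unitarymxP.
have uMt k : (M k)^t* \is unitarymx by rewrite trmxC_unitary.
have Bsurj b f : exists g, B b g = f.
  exists (MkEll2 (block_map_summable b uMt f)); apply: ell2_eqP => k.
  by rewrite /B /= block_mapK.
have Blin b : linear (B b).
  by move=> a f g; apply: ell2_eqP => k; rewrite ell2DE ell2ZE /= linearP.
have Binj b : injective (B b).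
  move=> f g fg; apply/val_inj.
  rewrite -[LHS](@block_mapK _ b (fun k => (M k)^t*) M)//;
    last by move=> k; apply/mulmx1C.
  rewrite -[RHS](@block_mapK _ b (fun k => (M k)^t*) M)//;
    last by move=> k; apply/mulmx1C.
  by congr (block_map _ _ _); exact: (congr1 val fg).
rewrite -mxrank_tr.
have sub f k : (T \- T') f k = cmv_map M f k - cmv_map M' f k by rewrite -TE -TE'.
case k0o: (oddz k0).
- apply: (@has_rank_factor _ _ (B false \o embed2 k0) (proj2 k0)).
  + by move=> a u v; rewrite /= embed2_linear Blin.
  + by apply: inj_comp; [exact: Binj|exact: embed2_inj].
  + by move=> v; exists (embed2 k0 v); rewrite proj2_embed2.
  move=> f; apply: ell2_eqP => k; rewrite sub /cmv_map /= -(MMn false) ?k0o//.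
  rewrite -[LHS]/((block_map false M (block_map true M f) -
    block_map false M (block_map true M' f)) k).
  rewrite -linearB; congr (block_map false M _ k); apply/funext => j.
  by have := block_mapB f MM j; rewrite k0o.
apply: (@has_rank_factor _ _ (embed2 k0) (proj2 k0 \o B true)).
- exact: embed2_linear.
- exact: embed2_inj.
- move=> v; have [g gE] := Bsurj true (embed2 k0 v).
  by exists g; rewrite /= gE proj2_embed2.
move=> f; apply: ell2_eqP => k; rewrite sub /cmv_map /= -(MMn true) ?k0o//.
by have := block_mapB (B true f) MM k; rewrite k0o.
Qed.
End Lattice.

(** * The complex exponential *)

Section Expi.
Variable R : realType.
Implicit Types x y : R.

Lemma expiD x y : expi (x + y) = expi x * expi y.
Proof. by rewrite /expi cosD sinD; simpc; congr Complex; ring. Qed.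

Lemma expiN x : expi (- x) = (expi x)^*.
Proof. by rewrite /expi cosN sinN. Qed.

Lemma expiMconj x : expi x * (expi x)^* = 1.
Proof. by rewrite -expiN -expiD subrr /expi cos0 sin0. Qed.

Lemma expi_int (n : int) : expi (n%:~R * (2 * pi)) = 1 :> R[i].
Proof.
have nat1 m : expi (m%:R * (2 * pi)) = 1 :> R[i].
  elim: m => [|m IHm]; first by rewrite mul0r /expi cos0 sin0.
  rewrite -natr1 mulrDl expiD IHm !mul1r mulr_natl mulr2n expiD /expi cospi sinpi.
  by simpc.
case: n => m; first exact: nat1.
by rewrite NegzE mulrNz mulNr expiN nat1 rmorph1.
Qed.

(** Reduce x to [0, 2 pi[, then to [0, pi], where cos is injective. *)
Lemma expi_eq1 x : expi x = 1 -> exists n : int, x = n%:~R * (2 * pi).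
Proof.
have pi0 := pi_gt0 R; have p20 : 0 < 2 * pi :> R by lra.
set n := Num.floor (x / (2 * pi)); pose y := x - n%:~R * (2 * pi) => x1.
have : expi y = 1 by rewrite /y expiD expiN expi_int x1 rmorph1 mulr1.
have y0 : 0 <= y by rewrite subr_ge0 -ler_pdivlMr// Num.Theory.floor_le.
have y2 : y < 2 * pi.
  by have := floorD1_gt (x / (2 * pi)); rewrite intrD ltr_pdivrMr// -/n /y; lra.
move=> [cy sy]; exists n; apply/eqP; rewrite -subr_eq0 -/y; apply/eqP.
have [ypi|ypi] := leP y pi.
  by apply: (@cos_inj R); rewrite ?cos0// in_itv/=; apply/andP; lra.
have : 2 * pi - y = 0.
  apply: (@cos_inj R); [rewrite in_itv/=; apply/andP; lra.. |].
  by rewrite mulr_natl cosB cos2pi sin2pi mul1r mul0r addr0 cy cos0.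
lra.
Qed.

Lemma expi_eqmod x y : expi x = expi y <-> eqmod2pi x y.
Proof.
split=> [xy|[n ->]]; last by rewrite expiD expi_int mulr1.
have [|n xyn] := @expi_eq1 (x - y); first by rewrite expiD expiN xy expiMconj.
by exists n; rewrite -xyn addrC subrK.
Qed.
End Expi.

(** * The CMV operators and the rank criterion *)

Section Cmv.
Variable R : realType.
Local Notation C := R[i].
Implicit Types (a : C) (alpha : verblunsky R) (t : R).

Lemma rho_sqr a : `|a| <= 1 -> rho a * rho a = 1 - a * a^*.
Proof.
have -> : `|a| = (Normc.normc a)%:C%C by case: a.
rewrite -[1 in X in X -> _]/(1%:C%C) lecR => a1.
have na0 : 0 <= Normc.normc a by case: (a) => x y; exact: sqrtr_ge0.
rewrite -sqnC -sqnE -expr2 /rho -rmorphXn /= sqr_sqrtr; first by rewrite rmorphB.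
by rewrite subr_ge0 expr_le1.
Qed.

Lemma rho_gt0 a : `|a| < 1 -> 0 < rho a * rho a.
Proof.
move=> a1; rewrite rho_sqr ?ltW// -normCK subr_gt0.
by rewrite expr_lt1// normr_ge0.
Qed.

Lemma ord2P (i : 'I_2) : i = 0 \/ i = 1.
Proof. by case: i => [[|[|//]] ?]; [left|right]; apply/val_inj. Qed.

Lemma unitarymx22 (A : 'M[C]_2) :
  A 0 0 * (A 0 0)^* + A 0 1 * (A 0 1)^* = 1 ->
  A 1 0 * (A 1 0)^* + A 1 1 * (A 1 1)^* = 1 ->
  A 0 0 * (A 1 0)^* + A 0 1 * (A 1 1)^* = 0 -> A \is unitarymx.
Proof.
move=> e00 e11 e01; apply/unitarymxP/matrixP => i j.
rewrite !mxE sum_ord2 !mxE.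
case: (ord2P i) => ->; case: (ord2P j) => -> //=.
have /(congr1 (fun x : C => x^*)) := e01.
rewrite rmorph0 rmorphD !rmorphM /= !conjCK => e10.
by apply: etrans e10; rewrite mulrC [X in _ + X]mulrC.
Qed.

Lemma Theta_unitary a : `|a| <= 1 -> Theta a \is unitarymx.
Proof.
move=> /rho_sqr ra.
have rhoR : (rho a)^* = rho a by rewrite /rho /=; simpc.
apply: unitarymx22; rewrite !mxE /= ?rhoR ?ra ?rmorphN ?conjCK; ring.
Qed.

Definition split_block (t1 t2 : R) : 'M[C]_2 :=
  \matrix_(i, j) if i != j then 0 else if i == 0 then - expi t1 else (expi t2)^*.

Lemma split_block_unitary t1 t2 : split_block t1 t2 \is unitarymx.
Proof.
have := expiMconj t1; have := expiMconj t2.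
by move=> e2 e1; apply: unitarymx22; rewrite !mxE /= ?rmorphN ?rmorph0
  ?conjCK ?mulr0 ?mul0r ?addr0 ?add0r ?mulrNN// mulrC.
Qed.

Lemma Theta_expi t : Theta (expi t) = split_block t t.
Proof. by apply/matrixP => i j; rewrite !mxE rho_expi; case: ifP. Qed.

Definition split_coef alpha k0 (t1 t2 : R) (k : int) : 'M[C]_2 :=
  if k == k0 then split_block t1 t2 else Theta (alpha k).

Lemma cmvE alpha (f : ell2 R int) :
  cmv alpha f = cmv_map (fun k => Theta (alpha k)) f :> (int -> C).
Proof. by []. Qed.

(** The block k0 is diagonal and so couples no position of one half-lattice to the
    other: the left half only meets its entry - e^(i t1), the right half only its
    entry e^(- i t2). *)
Lemma cmv_splitE alpha k0 t1 t2 (f : ell2 R int) :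
  cmv_split alpha k0 t1 t2 f = cmv_map (split_coef alpha k0 t1 t2) f :> (int -> C).
Proof.
have left_ b (g : int -> C) k : k <= k0 - 1 ->
    block_fun b (decoupled alpha k0 t1) g k = block_map b (split_coef alpha k0 t1 t2) g k.
  move=> kk0; rewrite /block_map /block_fun /= /set_coef /split_coef.
  have -> : (k == k0) = false by apply/eqP; lia.
  by case: (k + 1 == k0); rewrite // Theta_expi !mxE.
have right_ b (g : int -> C) k : k0 <= k ->
    block_fun b (decoupled alpha k0 t2) g k = block_map b (split_coef alpha k0 t1 t2) g k.
  move=> kk0; rewrite /block_map /block_fun /= /set_coef /split_coef.
  have -> : (k + 1 == k0) = false by apply/eqP; lia.
  by case: (k == k0); rewrite // Theta_expi !mxE.
apply/funext => k.
set D1 := decoupled alpha k0 t1; set D2 := decoupled alpha k0 t2.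
have -> : cmv_split alpha k0 t1 t2 f k =
    ext0 (restr (lhalf k0) (cmv D1 (ext0 (restr (lhalf k0) f)))) k +
    ext0 (restr (rhalf k0) (cmv D2 (ext0 (restr (rhalf k0) f)))) k by [].
rewrite !ext0E !unfold_in /lhalf /rhalf /cmv_map /=; have [kk0|kk0] := leP k0 k.
  rewrite ifF; last by lia.
  rewrite add0r -right_//; apply: block_local_right kk0 => {}k kk0.
  rewrite -right_//; apply: block_local_right kk0 => {}k kk0.
  by rewrite [LHS]ext0E unfold_in /rhalf kk0.
have {}kk0 : k <= k0 - 1 by lia.
rewrite kk0 addr0 -left_//; apply: block_local_left kk0 => {}k kk0.
rewrite -left_//; apply: block_local_left kk0 => {}k kk0.
by rewrite [LHS]ext0E unfold_in /lhalf kk0.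
Qed.

Lemma det_Theta_split a t1 t2 : `|a| <= 1 ->
  \det (Theta a - split_block t1 t2) =
  expi t1 * (a^* - (expi t2)^*) - (1 - a * (expi t2)^*).
Proof.
by move=> /rho_sqr ra; rewrite det_mx22 !mxE /= !subr0 ra; ring.
Qed.

Lemma expi_Arg (w : C) : w != 0 -> w = w^* * expi (2 * Arg w).
Proof.
move=> /ArgP[_ wE]; have rR : `|w|^* = `|w| by exact/CrealP/normr_real.
rewrite mulr_natl mulr2n expiD.
set r := `|w| in wE rR; set th := Arg w in wE *; rewrite wE rmorphM /= rR.
by rewrite mulrA -[r * _ * _]mulrA [_^* * _]mulrC expiMconj mulr1.
Qed.

(** With h = e^(i t2 / 2) and e = e^(2 i Arg w), the relation w = conj w * e of expi_Arg
    reads h - a conj h = (conj a h - conj h) e; times conj h it becomes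
    1 - a e^(- i t2) = (conj a - e^(- i t2)) e. The factor conj a - e^(- i t2) is not 0
    as |a| < 1, so that det X = 0 reduces to e^(i t1) = e. *)
Lemma det_Theta_split_eq0 a t1 t2 : `|a| < 1 ->
  \det (Theta a - split_block t1 t2) = 0 <->
  eqmod2pi t1 (2 * Arg ('i%C * (a * expi (- (t2 / 2)) - expi (t2 / 2)))).
Proof.
move=> a1; rewrite det_Theta_split ?ltW//; apply: iff_trans (expi_eqmod _ _).
set h := expi (t2 / 2); have hN : expi (- (t2 / 2)) = h^* by rewrite expiN.
have hh : h * h^* = 1 := expiMconj _.
have e2 : expi t2 = h * h by rewrite -expiD; congr expi; lra.
rewrite hN e2 rmorphM /=; set w := 'i%C * _; set e := expi (2 * _).
have nz b c : `|b| < 1 -> `|c| = 1 -> b - c != 0.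
  move=> b1 c1; apply/eqP => /eqP; rewrite subr_eq0 => /eqP bc.
  by move: b1; rewrite bc c1 ltxx.
have h1 : `|h| = 1 := normc_expi _.
have i0 : 'i%C != 0 :> C by rewrite eq_complex /= oner_eq0 andbF.
have w0 : w != 0.
  by apply: mulf_neq0 => //; apply: nz => //; rewrite normrM norm_conjC h1 mulr1.
have d0 : a^* - h^* * h^* != 0.
  by apply: nz; rewrite ?normrM !norm_conjC// h1 mulr1.
have key : 1 - a * (h^* * h^*) = (a^* - h^* * h^*) * e.
  have iN : ('i%C : C)^* = - 'i%C by simpc.
  have := expi_Arg w0; rewrite -/e {1 2}/w rmorphM rmorphB rmorphM /= conjCK iN.
  rewrite mulNr -mulrN -mulrA => /(mulfI i0) wE.
  transitivity (- h^* * (a * h^* - h)).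
    by rewrite mulrBr !mulNr (mulrC _ h) hh; ring.
  rewrite wE; transitivity (((h * h^*) * a^* - h^* * h^*) * e); last by rewrite hh mul1r.
  by ring.
rewrite key mulrC -mulrBr; split=> [/eqP|->]; last by rewrite subrr mulr0.
by rewrite mulf_eq0 (negPf d0) subr_eq0 => /eqP.
Qed.

Lemma det_Theta_expi_neq0 a t : `|a| < 1 -> \det (Theta a - split_block t t) <> 0.
Proof.
move=> a1; rewrite det_Theta_split ?ltW//.
have -> : expi t * (a^* - (expi t)^*) - (1 - a * (expi t)^*) =
    - ((expi t - a) * (expi t - a)^* + rho a * rho a).
  rewrite rho_sqr ?ltW// rmorphB /=.
  have e := expiMconj t; rewrite mulrBr e mulrBl !mulrBr e; ring.
move=> /eqP; rewrite oppr_eq0 gt_eqF// ltr_wpDl// ?rho_gt0//.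
by rewrite -normCK exprn_ge0.
Qed.

Lemma Theta_split_neq0 a t1 t2 : `|a| < 1 -> Theta a - split_block t1 t2 != 0.
Proof.
move=> /rho_gt0 r0; apply/eqP => /matrixP/(_ 0 1); rewrite !mxE /= subr0 => ra.
by move: r0; rewrite ra mul0r ltxx.
Qed.

End Cmv.

Theorem theorem2p3 (R : realType) (alpha : verblunsky R)
    (alpha_lt1 : forall k : int, `|alpha k| < 1)
    (t1 t2 : R) (t1_range : 0 <= t1 < 2 * pi) (t2_range : 0 <= t2 < 2 * pi)
    (k0 : int) (z : R[i]) (z_norm : `|z| != 1) :
  let U := cmv alpha in
  let U12 := cmv_split alpha k0 t1 t2 in
  let cond := eqmod2pi t1
    (2 * Arg ('i%C * (alpha k0 * expi (- (t2 / 2)) - expi (t2 / 2)))) in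
  [/\ bijective (shift_op U z) /\ bijective (shift_op U12 z),
      has_rank 1 (U \- U12) <-> cond,
      has_rank 1 (resolvent U z \- resolvent U12 z) <-> cond,
      ~ cond -> has_rank 2 (U \- U12) /\
                has_rank 2 (resolvent U z \- resolvent U12 z) &
      forall t : R, 0 <= t < 2 * pi ->
        let Ut := cmv (decoupled alpha k0 t) in
        [/\ bijective (shift_op Ut z),
            has_rank 2 (U \- Ut) &
            has_rank 2 (resolvent U z \- resolvent Ut z)]].
Proof.
move=> U U12 cond; pose a := alpha k0; have a1 : `|a| < 1 := alpha_lt1 k0.
pose M k := Theta (alpha k).
have uM k : M k \is unitarymx by apply: Theta_unitary; exact: vcoef_le1.
pose M' s1 s2 := split_coef alpha k0 s1 s2.
have uM' s1 s2 k : M' s1 s2 k \is unitarymx.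
  by rewrite /M' /split_coef; case: ifP => _; rewrite ?split_block_unitary ?uM.
have MM' s1 s2 k : k != k0 -> M k = M' s1 s2 k.
  by rewrite /M' /split_coef => /negPf ->.
have MB s1 s2 : M k0 - M' s1 s2 k0 = Theta a - split_block s1 s2.
  by rewrite /M' /split_coef eqxx.
have Uz : bijective (shift_op U z).
  by apply: (cmv_map_shift_bij (M := M)); [exact: uM|exact: cmvE|].
have Ulin : linear U by move=> c f g; rewrite /U linearP.
have split_z s1 s2 : bijective (shift_op (cmv_split alpha k0 s1 s2) z).
  by apply: (cmv_map_shift_bij (M := M' s1 s2));
    [exact: uM'|exact: cmv_splitE|].
have rankE s1 s2 n : has_rank n (U \- cmv_split alpha k0 s1 s2) <->
    \rank (Theta a - split_block s1 s2) = n.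
  rewrite -MB; exact: has_rank_cmv_mapB uM (uM' s1 s2) (MM' s1 s2) (cmvE alpha)
    (cmv_splitE alpha k0 s1 s2).
have resE s1 s2 n : has_rank n
    (resolvent U z \- resolvent (cmv_split alpha k0 s1 s2) z) <->
    \rank (Theta a - split_block s1 s2) = n.
  by apply: iff_trans (rankE s1 s2 n); exact: has_rank_resolventB.
have [rank1 rank2] := rank_mx22 (Theta_split_neq0 t1 t2 a1).
have det0 := det_Theta_split_eq0 t1 t2 a1.
split.
- by split; last exact: split_z.
- exact: iff_trans (rankE _ _ _) (iff_trans rank1 det0).
- exact: iff_trans (resE _ _ _) (iff_trans rank1 det0).
- move=> ncond; have r2 : \rank (Theta a - split_block t1 t2) = 2.
    by apply: rank2 => /det0.
  by split; [apply/rankE|apply/resE].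
move=> t _ Ut; have -> : Ut = cmv_split alpha k0 t t.
  by apply/funext; exact: cmv_decoupled_split.
have [_ r2] := rank_mx22 (Theta_split_neq0 t t a1).
by split=> //; [apply/rankE|apply/resE]; apply/r2/det_Theta_expi_neq0.
Qed.
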